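(* Let $q$ be a prime power, let $0\le k\le n$, and let $Z$ be a random vector in $\mathbb{F}_q^n$. Let $\mathcal{C}$ be uniformly distributed over the set $\mathscr{C}$ of all $[n,k]_q$ linear codes, and given $\mathcal{C}$ let $X_{\mathcal{C}}$ be a uniformly random codeword of $\mathcal{C}$, independent of $Z$. Then for every integer $p\ge 2$, $$\mathbb{E}_{\mathcal{C}\sim\mathscr{C}}\big[\|q^nP_{X_{\mathcal{C}}+Z}\|_p^p\big]\le\sum_{d=0}^p\binom{p}{d}q^{(p-d)(d+n-k-H_p(Z))}.$$
   Context: $P_{X_{\mathcal{C}}+Z}$ is the distribution of $X_{\mathcal{C}}+Z$ for fixed $\mathcal{C}$ (i.e. the convolution of $P_Z$ with the uniform distribution on $\mathcal{C}$). For $f:\mathbb{F}_q^n\to\mathbb{R}$, $\|f\|_p=\big(q^{-n}\sum_x|f(x)|^p\big)^{1/p}$. $H_p(Z)=\frac{1}{1-p}\log_q\sum_xP_Z(x)^p$. *)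

(* Defs.v *)
From mathcomp Require Import all_boot all_order all_algebra.
From mathcomp Require Import boolp reals exp.
Set Implicit Arguments. Unset Strict Implicit. Unset Printing Implicit Defensive.
Import Order.TTheory GRing.Theory Num.Theory.
Local Open Scope ring_scope.

Section Defs.
Variables (R : realType) (F : finFieldType) (n : nat).

Definition is_linear_code (k : nat) (C : {set 'rV[F]_n}) : Prop :=
  exists V : {vspace 'rV[F]_n}, \dim V = k /\ C = [set x | x \in V].

Definition is_distr (P : 'rV[F]_n -> R) : Prop :=
  (forall x, 0 <= P x) /\ \sum_x P x = 1.

(* distribution of X_C + Z, X_C uniform on C independent of Z *)
Definition conv_unif (P : 'rV[F]_n -> R) (C : {set 'rV[F]_n}) (x : 'rV[F]_n) : R :=
  (#|C|%:R)^-1 * \sum_(c in C) P (x - c).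

Definition normp_pow (p : nat) (f : 'rV[F]_n -> R) : R :=
  ((#|F| ^ n)%:R)^-1 * \sum_x `|f x| ^+ p.

Definition renyi (p : nat) (P : 'rV[F]_n -> R) : R :=
  (1 - p%:R)^-1 * (ln (\sum_x P x ^+ p) / ln (#|F|%:R)).

Definition expected_norm (k p : nat) (P : 'rV[F]_n -> R) : R :=
  (#|[set C : {set 'rV[F]_n} | `[< is_linear_code k C >]]|%:R)^-1 *
  \sum_(C : {set 'rV[F]_n} | `[< is_linear_code k C >])
     normp_pow p (fun x => (#|F| ^ n)%:R * conv_unif P C x).

End Defs.

(* Main.v *)
(** Expand the p-th power of the sum of P (x - c) over c in C as a sum over p-tuples of
    codewords. By GL-symmetry a tuple of rank r lies in a random [n,k] code with probability
    at most q^(-(n-k) r). A tuple of rank d contains d entries spanning the others, which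
    gives the factor binom(p, d), and the remaining m = p - d entries are linear combinations
    of these, which gives the factor q^(d m) after bounding, by the power mean inequality, an
    m-th power of a sum over combinations by a sum of m-th powers. It remains to see that, for
    x uniform, y_1, .., y_d i.i.d. of law P, and z = (1 - s) x + a_1 y_1 + .. + a_d y_d with
    s = a_1 + .. + a_d, one has E (P z)^m <= q^(- m H_p). If s <> 1 then z is uniform;
    otherwise some a_i is nonzero and Young's inequality for P(y_i) (P z)^m bounds the
    expectation by the sum of P^(m+1), to which interpolation between moments applies. *)
Require Import Defs.
From mathcomp Require Import all_boot all_order all_algebra all_field mxabelem.
From mathcomp Require Import boolp reals exp.
From mathcomp Require Import ring lra.
Set Implicit Arguments. Unset Strict Implicit. Unset Printing Implicit Defensive.
Import Order.TTheory GRing.Theory Num.Theory.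
Local Open Scope ring_scope.

(** * Codes containing a given subspace *)

(** Turns codes into row spaces of square matrices, where rank and GL_n arguments apply. Dimension
    and rank are matched by counting elements. *)
Lemma linear_codeP (F : finFieldType) (n k : nat) (C : {set 'rV[F]_n}) :
  is_linear_code k C <-> exists A : 'M[F]_n, \rank A = k /\ C = rowg A.
Proof.
have F_gt1 := finNzRing_gt1 F.
split=> [[V [dimV ->]]|[A [rkA ->]]].
- set C0 := [set x | x \in V].
  have eC : C0 = rowg (rowg_mx C0).
    apply/eqP; rewrite eqEsubset sub_rowg_mx /=; apply/subsetP=> u.
    rewrite mem_rowg genmxE => /submxP[a ->]; rewrite inE mulmx_sum_row.
    apply: memv_suml => i _; apply: memvZ; rewrite rowK.
    by have := enum_valP i; rewrite inE.
  exists (rowg_mx C0); split=> //.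
  apply: (expnI F_gt1); rewrite -card_rowg -eC -dimV -card_vspace.
  by rewrite cardsE.
- pose V : {vspace 'rV[F]_n} := <<enum (rowg A)>>%VS.
  have eV : rowg A = [set x | x \in V].
    apply/setP=> u; rewrite [RHS]in_set mem_rowg; apply/idP/idP=> [uA | uV].
      have uE : u \in enum (rowg A) by rewrite mem_enum mem_rowg.
      exact: memv_span uE.
    rewrite (coord_span uV); apply: summx_sub => i _; apply: scalemx_sub.
    rewrite -mem_rowg -mem_enum; apply: mem_nth.
    by rewrite -cardE; exact: ltn_ord.
  exists V; split=> //; apply: (expnI F_gt1).
  by rewrite -card_vspace -rkA -card_rowg eV cardsE.
Qed.

Definition codes_over {F : finFieldType} {n : nat} (k : nat) {m : nat}
    (B : 'M[F]_(m, n)) : {set {set 'rV[F]_n}} :=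
  [set C | `[< is_linear_code k C >] && (rowg B \subset C)].

Lemma codes_over_sub (F : finFieldType) (n k m1 m2 : nat)
    (A : 'M[F]_(m1, n)) (B : 'M[F]_(m2, n)) :
  (A <= B)%MS -> codes_over k B \subset codes_over k A.
Proof.
move=> sAB; apply/subsetP=> C; rewrite !inE => /andP[-> /=].
by apply: subset_trans; rewrite rowgS.
Qed.

(** Some [g] in GL_n carries the row space of [A] onto that of [B], and [C] to [C g] is then an
    injection between the two families of codes. *)
Lemma card_codes_over_rank (F : finFieldType) (n k m1 m2 : nat)
    (A : 'M[F]_(m1, n)) (B : 'M[F]_(m2, n)) :
  \rank A = \rank B -> (#|codes_over k A| <= #|codes_over k B|)%N.
Proof.
case/eq_rank_unitmx=> g g_unit eB.
have gI : injective (fun u : 'rV[F]_n => u *m g).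
  by move=> u w /(congr1 (mulmx^~ (invmx g))); rewrite /= !mulmxK.
rewrite -(card_imset _ (imset_inj gI)); apply/subset_leq_card/subsetP=> _ /imsetP[C + ->].
rewrite !inE => /andP[/asboolP cC sAC].
have [D [rkD eC]] := (linear_codeP _ _).1 cC; rewrite {}eC in sAC *.
have -> : [set u *m g | u in rowg D] = rowg (D *m g).
  apply/setP=> v; apply/imsetP/idP=> [[u uD ->]|].
    by rewrite mem_rowg submxMr // -mem_rowg.
  rewrite mem_rowg => vD; exists (v *m invmx g); last by rewrite mulmxKV.
  by rewrite mem_rowg -(mulmxK g_unit D) submxMr.
apply/andP; split; last by rewrite rowgS eB submxMr // -rowgS.
apply/asboolP/linear_codeP; exists (D *m g).
by rewrite mxrankMfree // row_free_unit.
Qed.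

Lemma rank_col_mx_row (F : fieldType) (n m : nat) (B : 'M[F]_(m, n)) (v : 'rV[F]_n) :
  \rank (col_mx v B) = (~~ (v <= B)%MS + \rank B)%N.
Proof.
rewrite -addsmxE addsmxC; case: (boolP (v <= B)%MS) => vB.
  by rewrite (addsmx_idPl vB).
have v0 : v != 0 by apply: contraNneq vB => ->; apply: sub0mx.
rewrite mxrank_disjoint_sum; first by rewrite (rank_rV v) v0 addnC.
apply/eqP/rowV0P=> w; rewrite sub_capmx => /andP[wB wv].
apply/eqP; apply: contraNT vB => w0.
apply: submx_trans wB; rewrite -(geq_leqif (mxrank_leqif_sup wv)).
by rewrite (rank_rV v) (rank_rV w) v0 w0.
Qed.

(* Double counting of the pairs (w, C) with C a code containing w and the rows of B: all w
   outside the row space of B contribute equally, by transitivity of GL_n. *)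
Lemma codes_over_step (F : finFieldType) (n k m : nat) (B : 'M[F]_(m, n))
    (v : 'rV[F]_n) : (k <= n)%N -> ~~ (v <= B)%MS ->
  (#|codes_over k (col_mx v B)| * #|F| ^ (n - k) <= #|codes_over k B|)%N.
Proof.
move=> kn vB; have F_gt0 : (0 < #|F|)%N := ltnW (finNzRing_gt1 F).
set M := #|codes_over k (col_mx v B)|; set N := #|codes_over k B|.
have double : \sum_(w : 'rV[F]_n) #|codes_over k (col_mx w B)| = (N * #|F| ^ k)%N.
  under eq_bigr => w _ do rewrite -sum1_card.
  rewrite (exchange_big_dep (mem (codes_over k B))) /=; last first.
    move=> w C _; apply: (subsetP (codes_over_sub _ _)).
    by rewrite -addsmxE addsmxSr.
  rewrite -sum_nat_const; apply: eq_bigr => C.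
  rewrite inE => /andP[/asboolP cC sBC].
  have [D [rkD eC]] := (linear_codeP _ _).1 cC.
  have -> : (#|F| ^ k)%N = #|C| by rewrite eC card_rowg rkD.
  rewrite sum1_card; apply: eq_card => w.
  transitivity (C \in codes_over k (col_mx w B)); first by [].
  rewrite in_set asboolT //=.
  by rewrite eC rowgS col_mx_sub -[(B <= D)%MS]rowgS -eC sBC andbT eC mem_rowg.
have split_sum : (N * #|F| ^ \rank B + M * (#|F| ^ n - #|F| ^ \rank B) = N * #|F| ^ k)%N.
  rewrite -double (bigID (mem (rowg B))) /= -card_rowg; congr (_ + _)%N.
    rewrite mulnC -sum_nat_const; apply: eq_bigr => w; rewrite mem_rowg => wB.
    apply/eqP; rewrite eqn_leq; apply/andP; split; apply: card_codes_over_rank;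
      by rewrite rank_col_mx_row wB.
  have -> : (#|F| ^ n - #|rowg B|)%N = #|[predC rowg B]|.
    have := cardC (mem (rowg B)); rewrite card_mx mul1n => <-.
    by rewrite addKn.
  rewrite mulnC -sum_nat_const; apply: eq_bigr => w; rewrite !inE => wB.
  apply/eqP; rewrite eqn_leq; apply/andP; split; apply: card_codes_over_rank;
    by rewrite !rank_col_mx_row (negPf vB) (negPf wB).
have rB : (\rank B < n)%N.
  have := rank_leq_col (col_mx v B); by rewrite rank_col_mx_row vB.
have lt_q : (#|F| ^ \rank B < #|F| ^ n)%N by rewrite ltn_exp2l // finNzRing_gt1.
(* With r the rank of [B], multiplying by q^n - q^r turns the left side into N (q^k - q^r) q^(n-k) =
   N (q^n - q^(r+n-k)), and r <= r + n - k. *)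
rewrite -(leq_pmul2r (m := (#|F| ^ n - #|F| ^ \rank B)%N)) ?subn_gt0 //.
rewrite mulnAC.
have -> : (M * (#|F| ^ n - #|F| ^ \rank B) = N * #|F| ^ k - N * #|F| ^ \rank B)%N.
  by rewrite -split_sum addKn.
rewrite mulnBl -!mulnA -!expnD subnKC // mulnBr; apply: leq_sub2l.
by rewrite leq_mul2l leq_pexp2l ?orbT // leq_addr.
Qed.

(** Induction on the rows: a row outside the span of those below it raises the rank by one and costs
    a factor q^(n-k); a dependent row changes neither the rank nor the count. *)
Lemma card_codes_over (F : finFieldType) (n k m : nat) (B : 'M[F]_(m, n)) :
  (k <= n)%N ->
  (#|codes_over k B| * #|F| ^ ((n - k) * \rank B)
     <= #|[set C : {set 'rV[F]_n} | `[< is_linear_code k C >]]|)%N.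
Proof.
move=> kn; elim: m B => [|m IH] B.
  rewrite flatmx0 mxrank0 muln0 muln1; apply/subset_leq_card/subsetP=> C.
  by rewrite !inE => /andP[].
rewrite -(vsubmxK (B : 'M_(1 + m, n))); set v := usubmx _; set B' := dsubmx _.
rewrite rank_col_mx_row; case: (boolP (v <= B')%MS) => vB /=.
  apply: leq_trans (IH B'); rewrite leq_mul2r; apply/orP; right.
  by apply: card_codes_over_rank; rewrite rank_col_mx_row vB.
apply: leq_trans (IH B'); rewrite mulnDr muln1 expnD mulnA leq_mul2r.
by rewrite codes_over_step ?orbT.
Qed.

(** * Moment inequalities *)

(** Induction on [m]: the gap between the sides at [m + 1] is [u] times the gap at [m] plus the
    square term [(m + 1) v^m (u - v)^2]. *)
Lemma young_mul_pow (R : realDomainType) (u v : R) (m : nat) : 0 <= u -> 0 <= v ->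
  m.+1%:R * (u * v ^+ m) <= u ^+ m.+1 + m%:R * v ^+ m.+1.
Proof.
move=> u0 v0; elim: m => [|m IH]; first by rewrite expr0 expr1 mul0r addr0 mul1r mulr1.
rewrite -subr_ge0; have {}IH := mulr_ge0 u0 (etrans (subr_ge0 _ _) IH).
have sq : 0 <= m.+1%:R * v ^+ m * (u - v) ^+ 2.
  by rewrite mulr_ge0 ?sqr_ge0 // mulr_ge0 ?ler0n ?exprn_ge0.
have := addr_ge0 IH sq; congr (is_true (0 <= _)).
by rewrite !exprS -!natr1; ring.
Qed.

(** Weighted AM-GM for [t ^+ b] and 1 with weights a and b - a. The induction on [b] combines
    [b + 1] times the hypothesis with [a] times Young's inequality for 1 and [t]. *)
Lemma young_pow_le (R : realDomainType) (t : R) (a b : nat) : 0 <= t -> (a <= b)%N ->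
  b%:R * t ^+ a <= a%:R * t ^+ b + (b%:R - a%:R).
Proof.
move=> t0; elim: b => [|b IH].
  by rewrite leqn0 => /eqP->; rewrite subrr !mul0r addr0.
rewrite leq_eqVlt => /predU1P[-> | ]; first by rewrite subrr addr0.
rewrite ltnS => ab; have {IH} := IH ab.
have [b0 | b_gt0] := posnP b.
  by move: ab; rewrite b0 leqn0 => /eqP-> _; rewrite mul0r expr0 mulr1 add0r subr0.
have := young_mul_pow b ler01 t0; rewrite expr1n mul1r => Y IH.
rewrite -(ler_pM2l (x := b%:R)) ?ltr0n //; rewrite -!natr1 in Y *.
have b0 : 0 <= b%:R + 1 :> R by rewrite addr_ge0 ?ler0n.
have a0 : 0 <= a%:R :> R by rewrite ler0n.
have /= {}Y := ler_wpM2l a0 Y; have /= {}IH := ler_wpM2l b0 IH.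
move: IH Y; lra.
Qed.

(* The factor #|I| on the left makes the inequality valid for m = 0 as well. *)
Lemma power_mean (R : realFieldType) (I : finType) (y : I -> R) (m : nat) :
  (forall i, 0 <= y i) ->
  #|I|%:R * (\sum_i y i) ^+ m <= #|I|%:R ^+ m * \sum_i y i ^+ m.
Proof.
move=> y0; case: m => [|m].
  by rewrite expr0 mulr1 expr0 mul1r sumr_const.
have [N0 | N_gt0] := posnP #|I|.
  by rewrite N0 mul0r exprS !mul0r.
set N : R := #|I|%:R; have N0 : 0 < N by rewrite ltr0n.
pose mu := (\sum_i y i) / N.
have mu0 : 0 <= mu by rewrite divr_ge0 ?sumr_ge0 ?ltW.
have eS : \sum_i y i = N * mu by rewrite mulrC divfK ?gt_eqF.
(* Young's inequality against the mean [mu] is the tangent-line bound behind Jensen's inequality. *)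
have : \sum_i m.+1%:R * (y i * mu ^+ m) <= \sum_i (y i ^+ m.+1 + m%:R * mu ^+ m.+1).
  by apply: ler_sum => i _; apply: young_mul_pow.
rewrite -mulr_sumr -mulr_suml big_split /= sumr_const -[_ *+ #|I|]mulr_natr -/N eS -natr1.
move=> H.
rewrite exprMn mulrCA ler_pM2l ?exprn_gt0 //.
by move: H; rewrite exprS; lra.
Qed.

Lemma sum_prod_rows (R : comPzRingType) (F : finFieldType) (d n : nat)
    (G : 'I_d -> 'rV[F]_n -> R) :
  \sum_(h : 'M[F]_(d, n)) \prod_i G i (row i h) = \prod_i \sum_u G i u.
Proof.
rewrite bigA_distr_bigA (reindex (fun h : 'M[F]_(d, n) => [ffun i => row i h])) /=.
  by apply: eq_bigr => h _; apply: eq_bigr => i _; rewrite ffunE.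
exists (fun f : {ffun 'I_d -> 'rV[F]_n} => \matrix_i f i) => [h _ | f _].
  by apply/row_matrixP=> i; rewrite rowK ffunE.
by apply/ffunP=> i; rewrite ffunE rowK.
Qed.

(** Apply [young_pow_le] to t = P x / lam and average under [P]: if the b-th moment of t is 1, its
    m-th moment is at most 1. *)
Lemma moment_interpolation (R : realFieldType) (I : finType) (P : I -> R)
    (lam : R) (b m : nat) :
  (forall x, 0 <= P x) -> \sum_x P x = 1 -> 0 < lam ->
  \sum_x P x ^+ b.+1 = lam ^+ b -> (m <= b)%N -> \sum_x P x ^+ m.+1 <= lam ^+ m.
Proof.
move=> P0 P1 lam0 Pb mb; have [b0 | b_gt0] := posnP b.
  by move: mb; rewrite b0 leqn0 => /eqP->; rewrite expr0 -P1 lexx.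
have lamE j : \sum_x P x * (P x / lam) ^+ j = (\sum_x P x ^+ j.+1) / lam ^+ j.
  by rewrite mulr_suml; apply: eq_bigr => x _; rewrite expr_div_n exprS mulrA.
have : \sum_x P x * (b%:R * (P x / lam) ^+ m)
    <= \sum_x P x * (m%:R * (P x / lam) ^+ b + (b%:R - m%:R)).
  apply: ler_sum => x _; apply: ler_wpM2l => //; apply: young_pow_le => //.
  by rewrite divr_ge0 // ltW.
under eq_bigr => x _ do rewrite mulrCA.
under [X in _ <= X -> _]eq_bigr => x _ do rewrite mulrDr mulrCA.
rewrite big_split /= -!mulr_sumr -mulr_suml P1 mul1r !lamE Pb.
rewrite divff ?expf_neq0 ?gt_eqF // mulr1 addrC subrK.
by rewrite -[X in _ <= X]mulr1 ler_pM2l ?ltr0n // ler_pdivrMr ?exprn_gt0 // mul1r.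
Qed.

(** Young's inequality splits the factor at row [i0] times [P (a *m h) ^+ m] into two pure powers
    with weights 1 and m; a change of variables shows that both have the same sum [S]. *)
Lemma sum_linform_moment (R : realFieldType) (F : finFieldType) (n d m : nat)
    (P : 'rV[F]_n -> R) (a : 'rV[F]_d) (i0 : 'I_d) :
  (forall x, 0 <= P x) -> \sum_x P x = 1 -> a 0 i0 != 0 ->
  \sum_(h : 'M[F]_(d, n)) (\prod_i P (row i h)) * P (a *m h) ^+ m
    <= \sum_u P u ^+ m.+1.
Proof.
move=> P0 P1 a0.
pose S := \sum_(h : 'M[F]_(d, n)) (\prod_(i | i != i0) P (row i h)) * P (row i0 h) ^+ m.+1.
have S_eq : S = \sum_u P u ^+ m.+1.
  transitivity (\sum_(h : 'M[F]_(d, n)) \prod_i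
      (if i == i0 then P (row i h) ^+ m.+1 else P (row i h))).
    apply: eq_bigr => h _; rewrite [RHS](bigD1 i0) //= eqxx mulrC; congr (_ * _).
    by apply: eq_bigr => i /negPf->.
  rewrite (sum_prod_rows (fun i u => if i == i0 then P u ^+ m.+1 else P u)).
  rewrite (bigD1 i0) //= eqxx [X in _ * X]big1 ?mulr1 // => i /negPf->.
  exact: P1.
(* a *m h replaces row i0 as a coordinate: a change of variables since a 0 i0 != 0. *)
pose subst_row (h : 'M[F]_(d, n)) := \matrix_i (if i == i0 then a *m h else row i h).
have subst_inj : injective subst_row.
  move=> h h' e; have e' i : row i (subst_row h) = row i (subst_row h') by rewrite e.
  have eN i : i != i0 -> row i h = row i h'.
    by move=> /negPf ii; have := e' i; rewrite !rowK ii.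
  apply/row_matrixP=> i; have [-> | /eN //] := eqVneq i i0.
  have := e' i0; rewrite !rowK eqxx !mulmx_sum_row (bigD1 i0) //= [RHS](bigD1 i0) //=.
  rewrite (eq_bigr (fun j => a 0 j *: row j h')) => [|j /eN-> //].
  by move=> /addIr /(scalerI a0).
have S_subst : \sum_(h : 'M[F]_(d, n))
    (\prod_(i | i != i0) P (row i h)) * P (a *m h) ^+ m.+1 = S.
  rewrite /S [RHS](reindex_inj subst_inj); apply: eq_bigr => h _.
  rewrite rowK eqxx; congr (_ * _); apply: eq_bigr => i /negPf ii.
  by rewrite rowK ii.
rewrite -(ler_pM2l (x := m.+1%:R)) ?ltr0n // mulr_sumr.
have -> : m.+1%:R * (\sum_u P u ^+ m.+1) = S + m%:R * S.
  by rewrite S_eq -natr1 mulrDl mul1r addrC.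
rewrite -{2}S_subst /S mulr_sumr -big_split /=; apply: ler_sum => h _.
rewrite (bigD1 i0) //=; set Q := \prod_(i | i != i0) _.
rewrite (mulrC _ Q) -mulrA [X in X <= _]mulrCA [m%:R * _]mulrCA -mulrDr.
by apply: ler_wpM2l; [rewrite /Q prodr_ge0 | apply: young_mul_pow].
Qed.

(* Here lam stands for q^(- H_p(P)). *)
Lemma sum_affine_moment (R : realFieldType) (F : finFieldType) (n d m : nat)
    (P : 'rV[F]_n -> R) (lam : R) (a : 'rV[F]_d) :
  (forall x, 0 <= P x) -> \sum_x P x = 1 -> 0 < lam -> (1 < d + m)%N ->
  \sum_x P x ^+ (d + m) = lam ^+ (d + m).-1 ->
  \sum_x \sum_(h : 'M[F]_(d, n)) (\prod_i P (x - row i h)) * P (x - a *m h) ^+ m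
    <= #|{: 'rV[F]_n}|%:R * lam ^+ m.
Proof.
move=> P0 P1 lam0 dm1 Plam; set N : R := #|_|%:R.
have N0 : 0 < N by rewrite ltr0n; apply/card_gt0P; exists 0.
have moment j : (j.+1 <= d + m)%N -> \sum_x P x ^+ j.+1 <= lam ^+ j.
  move=> jdm; apply: (moment_interpolation (b := (d + m).-1)) => //.
    by rewrite prednK // ltnW.
  by rewrite -ltnS prednK // ltnW.
(* Cauchy-Schwarz and the second moment. In the case s <> 1 this pays for the missing factor [lam],
   since the moment of order m only gives [lam ^+ m.-1]. *)
have Nlam : 1 <= N * lam.
  have := power_mean 2 P0; rewrite P1 expr1n mulr1 -/N expr2 -mulrA => H.
  have {}H : 1 <= N * \sum_x P x ^+ 2.
    by rewrite -(ler_pM2l N0) mulr1.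
  apply: le_trans H _; apply: ler_wpM2l; first exact: ltW.
  by rewrite -[lam]expr1; apply: moment.
pose s := \sum_i a 0 i.
have -> : \sum_x \sum_(h : 'M[F]_(d, n)) (\prod_i P (x - row i h)) * P (x - a *m h) ^+ m
    = \sum_(h : 'M[F]_(d, n)) (\prod_i P (row i h)) *
        \sum_x P ((1 - s) *: x + a *m h) ^+ m.
  under [RHS]eq_bigr => h _ do rewrite mulr_sumr.
  rewrite [RHS]exchange_big /=; apply: eq_bigr => x _.
  (* Substitute y_i = x - c_i for the rows of h. *)
  pose X : 'M[F]_(d, n) := \matrix_i x.
  rewrite (reindex_inj (can_inj (subKr X))) /=; apply: eq_bigr => h _.
  congr (_ * P _ ^+ _).
    by apply: eq_bigr => i _; rewrite linearB /= rowK subKr.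
  rewrite mulmxBr opprB addrA scalerBl scale1r addrAC; congr (_ - _ + _).
  by rewrite mulmx_sum_row /s scaler_suml; apply: eq_bigr => i _; rewrite rowK.
have P1h : \sum_(h : 'M[F]_(d, n)) \prod_i P (row i h) = 1.
  by rewrite (sum_prod_rows (fun _ => P)) big1.
have [s1 | s1] := eqVneq s 1.
  have [i0 ai0] : exists i, a 0 i != 0.
    apply/existsP; apply: contraT; rewrite negb_exists => /forallP a0.
    by move: s1; rewrite /s big1 => [/esym/eqP|i _]; [rewrite oner_eq0 | apply/eqP/negPn].
  have const h : \sum_x P ((1 - s) *: x + a *m h) ^+ m = N * P (a *m h) ^+ m.
    rewrite s1 subrr (eq_bigr (fun=> P (a *m h) ^+ m)) => [|x _].
      by rewrite sumr_const -mulr_natl.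
    by rewrite scale0r add0r.
  under eq_bigr => h _ do rewrite const mulrCA.
  rewrite -mulr_sumr; apply: ler_wpM2l; first exact: ltW.
  apply: le_trans (sum_linform_moment _ P0 P1 ai0) (moment _ _).
  (* The order m + 1 is within range because the index [i0] forces d >= 1. *)
  by rewrite -add1n leq_add2r; apply: leq_ltn_trans (ltn_ord i0).
have unif h : \sum_x P ((1 - s) *: x + a *m h) ^+ m = \sum_x P x ^+ m.
  rewrite [RHS](reindex_inj (h := fun x => (1 - s) *: x + a *m h)) //= => x y.
  by move=> /addIr /scalerI; apply; rewrite subr_eq0 eq_sym.
under eq_bigr => h _ do rewrite unif.
rewrite -mulr_suml P1h mul1r; case: m dm1 Plam moment {unif} => [|j] dm1 Plam moment.
  by under eq_bigr do rewrite expr0; rewrite sumr_const mulr1.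
apply: le_trans (moment j _) _; first by rewrite leq_addl.
by rewrite exprS mulrA ler_peMl // exprn_ge0 // ltW.
Qed.

(** * Tuples spanned by a subfamily *)

Definition subrows {F : finFieldType} {p n : nat} (S : {set 'I_p})
    (f : {ffun 'I_p -> 'rV[F]_n}) : 'M[F]_(#|S|, n) :=
  \matrix_l f (enum_val l).

Definition spanned_by {F : finFieldType} {p n : nat} (S : {set 'I_p})
    (f : {ffun 'I_p -> 'rV[F]_n}) : bool :=
  [forall i, (f i <= subrows S f)%MS].

Lemma spanned_by_rank (F : finFieldType) (p n : nat) (f : {ffun 'I_p -> 'rV[F]_n}) :
  exists2 S : {set 'I_p}, spanned_by S f & #|S| = \rank (\matrix_i f i).
Proof.
set A := \matrix_i f i; pose S := [set maxrankfun A l | l : 'I_(\rank A)].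
exists S; last by rewrite card_imset ?card_ord //; apply: maxrankfun_inj.
apply/forallP=> i; have -> : f i = row i A by rewrite rowK.
apply: submx_trans (row_sub i A) _; rewrite -eq_maxrowsub.
apply/row_subP=> l; rewrite row_rowsub rowK.
have lS : maxrankfun A l \in S by apply: imset_f.
have -> : f (maxrankfun A l) = row (enum_rank_in lS (maxrankfun A l)) (subrows S f).
  by rewrite rowK enum_rankK_in.
exact: row_sub.
Qed.

(** Once the matrix [h] of the entries indexed by [S] is fixed, the other entries range
    independently over the row space of [h], so the sum factors. *)
Lemma sum_spanned_by (R : comPzRingType) (F : finFieldType) (p n : nat)
    (S : {set 'I_p}) (g : 'rV[F]_n -> R) :
  \sum_(f : {ffun 'I_p -> 'rV[F]_n} | spanned_by S f) \prod_i g (f i)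
  = \sum_(h : 'M[F]_(#|S|, n)) (\prod_l g (row l h)) *
      (\sum_(w | (w <= h)%MS) g w) ^+ (p - #|S|).
Proof.
rewrite (partition_big (subrows S) predT) //=; apply: eq_bigr => h _.
(* [Q i] describes the values allowed at index [i]; for [i] in [S] the quantifier singles out the
   one row of [h] attached to [i]. *)
pose Q i w := if i \in S then [forall l : 'I_#|S|, (enum_val l == i) ==> (w == row l h)]
              else (w <= h)%MS.
transitivity (\prod_i \sum_(w | Q i w) g w).
  rewrite bigA_distr_big_dep; apply: eq_bigl => f.
  apply/andP/familyP=> [[/forallP fS /eqP fh] i|fQ].
    rewrite -[_ \in _]/(Q i (f i)) /Q -fh; case: ifP => // iS.
    apply/forallP=> l; apply/implyP=> /eqP <-.
    by rewrite rowK.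
  have {}fQ i : Q i (f i) := fQ i.
  have fh : subrows S f = h.
    apply/row_matrixP=> l; rewrite rowK.
    have := fQ (enum_val l); rewrite /Q enum_valP => /forallP/(_ l).
    by rewrite eqxx => /eqP.
  split; last exact/eqP.
  apply/forallP=> i; have := fQ i; rewrite /Q fh; case: ifP => // iS.
  move/forallP/(_ (enum_rank_in iS i)); rewrite enum_rankK_in // eqxx => /eqP->.
  exact: row_sub.
rewrite (bigID (mem S)) /= big_enum_val /=; congr (_ * _).
  apply: eq_bigr => l _; apply: big_pred1 => w; rewrite /Q enum_valP.
  apply/forallP/eqP=> [/(_ l)|-> l']; first by rewrite eqxx => /eqP.
  by apply/implyP=> /eqP /enum_val_inj->.
rewrite (eq_bigr (fun=> \sum_(w | (w <= h)%MS) g w)); last first.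
  by move=> i /negPf iS; rewrite /Q iS.
rewrite (eq_bigl (mem (~: S))) => [|i]; last by rewrite !inE.
by rewrite prodr_const cardsCs setCK card_ord.
Qed.

(** Each [w] in the row space has at least one coefficient vector, and any further ones add
    nonnegative terms. *)
Lemma sum_submx_le (R : numDomainType) (F : finFieldType) (d n : nat)
    (h : 'M[F]_(d, n)) (g : 'rV[F]_n -> R) : (forall w, 0 <= g w) ->
  \sum_(w | (w <= h)%MS) g w <= \sum_(a : 'rV[F]_d) g (a *m h).
Proof.
move=> g0; rewrite (partition_big (mulmx^~ h) (fun w => (w <= h)%MS)) /=; last first.
  by move=> a _; apply: submxMl.
apply: ler_sum => _ /submxP[a0 ->]; rewrite (bigD1 a0) //= ?eqxx //.
by rewrite lerDl sumr_ge0.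
Qed.

Lemma sum_spanned_by_le (R : realFieldType) (F : finFieldType) (n p : nat)
    (P : 'rV[F]_n -> R) (lam : R) (S : {set 'I_p}) :
  (forall x, 0 <= P x) -> \sum_x P x = 1 -> 0 < lam -> (1 < p)%N ->
  \sum_x P x ^+ p = lam ^+ p.-1 ->
  \sum_x \sum_(f : {ffun 'I_p -> 'rV[F]_n} | spanned_by S f) \prod_i P (x - f i)
    <= (#|F| ^ n)%:R * ((#|F| ^ #|S|)%:R * lam) ^+ (p - #|S|).
Proof.
move=> P0 P1 lam0 p1 Plam; have F_gt0 : (0 < #|F|)%N := ltnW (finNzRing_gt1 F).
set Q : R := (#|F| ^ #|S|)%:R; set m := (p - #|S|)%N.
have Q0 : 0 < Q by rewrite ltr0n expn_gt0 F_gt0.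
have dm : (#|S| + m)%N = p.
  by rewrite /m subnKC //; have := max_card S; rewrite card_ord.
have QE : Q = #|{: 'rV[F]_#|S|}|%:R by rewrite card_mx mul1n.
(* The extra factor [Q] gives the shape of [power_mean] over the [Q] coefficient vectors [a]; on the
   right it counts these vectors, each contributing at most N lam^m. *)
rewrite -(ler_pM2l Q0).
apply: (@le_trans _ _ (Q ^+ m * \sum_(a : 'rV[F]_#|S|) \sum_x
    \sum_(h : 'M[F]_(#|S|, n)) (\prod_l P (x - row l h)) * P (x - a *m h) ^+ m)).
  rewrite [X in _ <= _ * X]exchange_big !mulr_sumr /=; apply: ler_sum => x _.
  rewrite (sum_spanned_by S (fun w => P (x - w))) -/m [X in _ <= _ * X]exchange_big !mulr_sumr /=.
  apply: ler_sum => h _; rewrite -mulr_sumr mulrCA [X in _ <= X]mulrCA.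
  apply: ler_wpM2l; first by apply: prodr_ge0.
  have := power_mean m (fun a : 'rV[F]_#|S| => P0 (x - a *m h)); rewrite -QE.
  apply: le_trans; apply: ler_wpM2l; first exact: ltW.
  apply: lerXn2r; rewrite ?nnegrE ?sumr_ge0 //.
  exact: (sum_submx_le _ (fun w => P0 (x - w))).
set N : R := (#|F| ^ n)%:R.
have -> : Q * (N * (Q * lam) ^+ m) = Q ^+ m * (Q * (N * lam ^+ m)).
  by rewrite exprMn; ring.
apply: ler_wpM2l; first by rewrite exprn_ge0 // ltW.
rewrite QE mulr_natl -sumr_const; apply: ler_sum => a _.
have := @sum_affine_moment _ _ _ _ m _ _ a P0 P1 lam0.
by rewrite dm card_mx mul1n; apply.
Qed.

(** * The expected norm *)

(** After expansion, a tuple occurs once for every code that contains all its entries. *)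
Lemma sum_codes_expn (R : comPzRingType) (F : finFieldType) (n k p : nat)
    (g : 'rV[F]_n -> R) :
  \sum_(C : {set 'rV[F]_n} | `[< is_linear_code k C >]) (\sum_(c in C) g c) ^+ p
  = \sum_(f : {ffun 'I_p -> 'rV[F]_n})
      #|codes_over k (\matrix_i f i)|%:R * \prod_i g (f i).
Proof.
transitivity (\sum_(C : {set 'rV[F]_n} | `[< is_linear_code k C >])
    \sum_(f in ffun_on C) \prod_(i < p) g (f i)).
  apply: eq_bigr => C _; rewrite -[in LHS](card_ord p) -prodr_const.
  exact: (bigA_distr_big_dep (fun _ : 'I_p => mem C)).
rewrite (exchange_big_dep predT) //=; apply: eq_bigr => f _.
rewrite sumr_const mulr_natl; congr (_ *+ _).
apply: eq_card => C; rewrite [RHS]in_set; apply: andb_id2l => /asboolP.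
case/linear_codeP=> D [_ ->]; rewrite rowgS.
apply/ffun_onP/row_subP=> fD i; have := fD i; by rewrite ?rowK mem_rowg.
Qed.

Lemma powR_renyi (R : realType) (F : finFieldType) (n p : nat) (P : 'rV[F]_n -> R) :
  is_distr P -> (1 < p)%N ->
  \sum_x P x ^+ p = (#|F|%:R `^ (- renyi p P)) ^+ p.-1.
Proof.
move=> [P0 P1] p1; have q1 : 1 < #|F|%:R :> R by rewrite ltr1n finNzRing_gt1.
have N0 : 0 < #|{: 'rV[F]_n}|%:R :> R by rewrite ltr0n; apply/card_gt0P; exists 0.
(* Positivity, required to invert [ln], comes from the power mean inequality. *)
have S0 : 0 < \sum_x P x ^+ p.
  have := power_mean p P0; rewrite P1 expr1n mulr1 => /(lt_le_trans N0).
  by rewrite pmulr_rgt0 // exprn_gt0.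
rewrite -powR_mulrn ?powR_ge0 // -powRrM /renyi /powR gt_eqF; last first.
  by apply: lt_trans q1.
have -> : (1 - p%:R)^-1 = - (p.-1%:R)^-1 :> R.
  by rewrite -[in LHS](prednK (ltnW p1)) -natr1 opprD addrCA subrr addr0 invrN.
have p0 : p.-1%:R != 0 :> R by rewrite pnatr_eq0 -lt0n -ltnS prednK // ltnW.
set L := ln _ / ln _; have -> : - (- p.-1%:R^-1 * L) * p.-1%:R = L.
  by rewrite !mulNr opprK mulrAC mulVf ?mul1r.
by rewrite /L divfK ?gt_eqF ?ln_gt0 // lnK.
Qed.

Lemma sum_by_card (R : pzSemiRingType) (p : nat) (G : nat -> R) :
  \sum_(S : {set 'I_p}) G #|S| = \sum_(d < p.+1) 'C(p, d)%:R * G d.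
Proof.
have cardS (S : {set 'I_p}) : (#|S| < p.+1)%N by rewrite ltnS -[X in (_ <= X)%N]card_ord max_card.
rewrite (partition_big (fun S : {set 'I_p} => Ordinal (cardS S)) predT) //=.
apply: eq_bigr => d _; rewrite (eq_bigr (fun=> G d)) => [|S /eqP <- //].
rewrite sumr_const mulr_natl; congr (_ *+ _).
have := card_draws 'I_p d; rewrite card_ord => <-.
by apply: eq_card => S; rewrite [RHS]in_set.
Qed.

(** Each tuple is charged to one spanning index set [S] whose size is its rank; the other sets only
    add nonnegative terms. With K = q^(n-k), the part K^|S| of K^p is absorbed by the count of codes
    over the tuple, and the rest goes to the remaining p - |S| entries. *)
Lemma sum_codes_moment_le (R : realFieldType) (F : finFieldType) (n k p : nat)
    (P : 'rV[F]_n -> R) (lam : R) :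
  (k <= n)%N -> (forall x, 0 <= P x) -> \sum_x P x = 1 -> 0 < lam -> (1 < p)%N ->
  \sum_x P x ^+ p = lam ^+ p.-1 ->
  ((#|F| ^ (n - k))%:R) ^+ p *
    \sum_x \sum_(C : {set 'rV[F]_n} | `[< is_linear_code k C >])
      (\sum_(c in C) P (x - c)) ^+ p
  <= #|[set C : {set 'rV[F]_n} | `[< is_linear_code k C >]]|%:R *
     ((#|F| ^ n)%:R * \sum_(d < p.+1) 'C(p, d)%:R *
        ((#|F| ^ d)%:R * (#|F| ^ (n - k))%:R * lam) ^+ (p - d)).
Proof.
move=> kn P0 P1 lam0 p1 Plam; set K : R := (#|F| ^ (n - k))%:R.
set T : R := #|_|%:R.
have K0 : 0 <= K by rewrite ler0n.
have step1 x : K ^+ p * \sum_(C : {set 'rV[F]_n} | `[< is_linear_code k C >])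
      (\sum_(c in C) P (x - c)) ^+ p
    <= \sum_(S : {set 'I_p}) T * K ^+ (p - #|S|) *
         \sum_(f : {ffun 'I_p -> 'rV[F]_n} | spanned_by S f) \prod_i P (x - f i).
  rewrite (sum_codes_expn k p (fun u => P (x - u))).
  under [X in _ <= X]eq_bigr => S _ do rewrite mulr_sumr.
  rewrite (exchange_big_dep predT) //= mulr_sumr; apply: ler_sum => f _.
  have [S fS cS] := spanned_by_rank f.
  rewrite (bigD1 S) //= mulrA ler_wpDr //.
    by apply: sumr_ge0 => S' _; rewrite !mulr_ge0 ?exprn_ge0 ?ler0n ?prodr_ge0.
  apply: ler_wpM2r; first exact: prodr_ge0.
  have Sp : (#|S| <= p)%N by have := max_card S; rewrite card_ord.
  rewrite -{1}(subnK Sp) exprD -mulrA (mulrC T).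
  apply: ler_wpM2l; first exact: exprn_ge0.
  by rewrite mulrC -natrX -natrM ler_nat -expnM cS card_codes_over.
rewrite mulr_sumr; apply: le_trans (ler_sum _ (fun x _ => step1 x)) _.
rewrite exchange_big /=.
under eq_bigr => S _ do rewrite -mulr_sumr.
rewrite -(sum_by_card p (fun d => ((#|F| ^ d)%:R * K * lam) ^+ (p - d))) !mulr_sumr.
apply: ler_sum => S _.
have T0 : 0 <= T * K ^+ (p - #|S|) by rewrite mulr_ge0 ?exprn_ge0 ?ler0n.
apply: le_trans (ler_wpM2l T0 (sum_spanned_by_le S P0 P1 lam0 p1 Plam)) _.
by rewrite mulrAC !exprMn le_eqVlt; apply/orP; left; apply/eqP; ring.
Qed.

Theorem theorem3p3 (R : realType) (F : finFieldType) (n k : nat)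
  (P : 'rV[F]_n -> R) (p : nat) :
  (k <= n)%N -> is_distr P -> (2 <= p)%N ->
  expected_norm k p P <=
  \sum_(d < p.+1)
     'C(p, d)%:R *
     powR (#|F|%:R : R)
       ((p%:R - d%:R) * (d%:R + n%:R - k%:R - renyi p P)).
Proof.
move=> kn dP p1; have [P0 P1] := dP.
have q0 : 0 < #|F|%:R :> R by rewrite ltr0n (ltnW (finNzRing_gt1 F)).
have qX j : 0 < (#|F| ^ j)%:R :> R by rewrite natrX exprn_gt0.
set q : R := #|F|%:R in q0 *; pose lam := q `^ (- renyi p P).
have lam0 : 0 < lam by apply: powR_gt0.
have -> : \sum_(d < p.+1) 'C(p, d)%:R *
      q `^ ((p%:R - d%:R) * (d%:R + n%:R - k%:R - renyi p P))
    = \sum_(d < p.+1) 'C(p, d)%:R *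
      ((#|F| ^ d)%:R * (#|F| ^ (n - k))%:R * lam) ^+ (p - d).
  apply: eq_bigr => d _; congr (_ * _).
  have dp : (d <= p)%N by rewrite -ltnS.
  rewrite -natrB // mulrC powRrM powR_mulrn ?powR_ge0 //; congr (_ ^+ _).
  rewrite -(addrA d%:R) -natrB // !natrX -/q /lam -!powR_mulrn ?ltW //.
  by rewrite !powRD ?(gt_eqF q0) ?implybT.
rewrite /expected_norm; set T : R := #|_|%:R.
(* For [T] = 0 the inverse is 0 by convention, so the left side vanishes. *)
have [T0 | T0] := eqVneq T 0.
  rewrite T0 invr0 mul0r sumr_ge0 // => d _.
  by rewrite mulr_ge0 ?exprn_ge0 ?mulr_ge0 ?ler0n ?ltW.
have T_gt0 : 0 < T by rewrite lt_def T0 ler0n.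
rewrite ler_pdivrMl //.
(* Since |C| = q^k, the normalisation q^n / |C| is q^(n-k). *)
have normE (C : {set 'rV[F]_n}) : `[< is_linear_code k C >] ->
    normp_pow p (fun x => (#|F| ^ n)%:R * conv_unif P C x)
    = (#|F| ^ n)%:R^-1 * ((#|F| ^ (n - k))%:R ^+ p *
        \sum_x (\sum_(c in C) P (x - c)) ^+ p).
  move=> /asboolP /linear_codeP[D [rkD eC]]; rewrite /normp_pow; congr (_ * _).
  rewrite mulr_sumr; apply: eq_bigr => x _; rewrite -exprMn /conv_unif; congr (_ ^+ _).
  rewrite {1}eC card_rowg rkD mulrA ger0_norm; last first.
    by rewrite mulr_ge0 ?sumr_ge0 // divr_ge0 ?ler0n.
  congr (_ * _); rewrite -{1}(subnK kn) expnD natrM mulfK ?gt_eqF //.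
rewrite (eq_bigr _ normE) -!mulr_sumr exchange_big ler_pdivrMl // mulrCA.
exact: sum_codes_moment_le (powR_renyi dP p1).
Qed.
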